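(* Let $R_F>0$, $R_L>R_F$, $v>0$ and $\theta>0$ be real numbers, and let $\hat X\in\mathbb{R}^6$ be the efficient risky portfolio (defined in the context) built from the five given typical assets together with a lottery drawing with expected rate of return $R_L$ and variance $v$, when the risk-free rate is $R_F$. If $$v\ \ge\ \frac{R_L-R_F}{0.022\,\theta},$$ then the efficient portfolio contains a negligible fraction of lottery tickets, i.e. $|\hat X_6|<\theta$.
   Context: Rates of return are weekly, in percent; covariances are in $\%^2$. The five typical assets have expected return vector $\mu=(0.057,\,0.242,\,0.266,\,0.109,\,0.147)^T$ and symmetric covariance matrix $$C=\begin{pmatrix}0.198&0.128&0.037&-0.077&-0.141\\0.128&5.623&2.028&0.488&0.653\\0.037&2.028&4.748&0.335&0.419\\-0.077&0.488&0.335&10.042&10.210\\-0.141&0.653&0.419&10.210&12.857\end{pmatrix}.$$ The lottery is asset 6, uncorrelated with the others: $\hat\mu=\begin{pmatrix}\mu\\R_L\end{pmatrix}$ and $\hat C=\begin{pmatrix}C&0\\0&v\end{pmatrix}$. With $\mathbf 1=(1,\dots,1)^T\in\mathbb{R}^6$, set $\hat Z=\hat C^{-1}(\hat\mu-R_F\mathbf 1)$. The efficient risky portfolio is $\hat X=\hat Z/\sum_{k=1}^6|\hat Z_k|$; the fraction invested in asset $k$ is $|\hat X_k|$. An investment is called negligible if its fraction of the total is less than $\theta$. *)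

(* Defs.v *)
From HB Require Import structures.
From mathcomp Require Import all_boot all_order all_algebra.
From mathcomp Require Import reals.

Set Implicit Arguments.
Unset Strict Implicit.
Unset Printing Implicit Defensive.

Import Order.TTheory GRing.Theory Num.Theory.
Local Open Scope ring_scope.

(* Rates of return are weekly, in percent; covariances are in
   percent squared. *)

(* The decimal n.abc is written [dec R n abc]: the second argument is always
   spelled with three digits, e.g. 0.057 is [dec R 0 057].  Negative decimals
   are [- dec R n abc].  (Splitting off the integer part keeps the unary
   naturals below 1000.) *)
Definition dec (R : realType) (n m : nat) : R := n%:R + m%:R / 1000.

Section GeneralMarket.
Variables (R : realType) (n : nat).

(* Z = C^-1 (mu - R_F 1); [invmx] is the inverse only when C is
   invertible. *)
Definition portfolio_direction (mu : 'cV[R]_n) (C : 'M[R]_n) (RF : R) :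
    'cV[R]_n :=
  invmx C *m (mu - RF *: const_mx 1).

(* Short positions are allowed, so the normalization is by the sum of the
   absolute values. *)
Definition efficient_portfolio (mu : 'cV[R]_n) (C : 'M[R]_n) (RF : R) :
    'cV[R]_n :=
  let Z := portfolio_direction mu C RF in
  (\sum_(k < n) `|Z k 0|)^-1 *: Z.

Definition fraction_invested (X : 'cV[R]_n) (k : 'I_n) : R := `|X k 0|.

Definition negligible (theta : R) (X : 'cV[R]_n) (k : 'I_n) : Prop :=
  fraction_invested X k < theta.

End GeneralMarket.

Definition typical_mu (R : realType) : 'cV[R]_5 :=
  let d := dec R in
  \col_(i < 5) [:: d 0 057; d 0 242; d 0 266; d 0 109; d 0 147]`_i.

Definition typical_C (R : realType) : 'M[R]_5 :=
  let d := dec R in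
  \matrix_(i < 5, j < 5)
    (nth [::]
      [:: [::   d 0 198;  d 0 128; d 0 037; - d 0 077; - d 0 141];
          [::   d 0 128;  d 5 623; d 2 028;   d 0 488;   d 0 653];
          [::   d 0 037;  d 2 028; d 4 748;   d 0 335;   d 0 419];
          [:: - d 0 077;  d 0 488; d 0 335;  d 10 042;  d 10 210];
          [:: - d 0 141;  d 0 653; d 0 419;  d 10 210;  d 12 857]] i)`_j.

Definition mu_hat (R : realType) (RL : R) : 'cV[R]_(5 + 1) :=
  col_mx (typical_mu R) (const_mx RL).

Definition C_hat (R : realType) (v : R) : 'M[R]_(5 + 1) :=
  block_mx (typical_C R) 0 0 v%:M.

(* Asset 6, i.e. the index of value 5. *)
Definition lottery : 'I_(5 + 1) := rshift 5 ord0.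

(* Main.v *)
Require Import Defs.
From mathcomp Require Import all_boot all_order all_algebra.
From mathcomp Require Import reals.
From mathcomp Require Import ring lra.
Import Order.TTheory GRing.Theory Num.Theory.
Local Open Scope ring_scope.

(** The block structure of the covariance matrix gives Z_6 = (RL - RF) / v,
    which the hypothesis bounds by 0.022 theta, while the typical part of Z does
    not depend on the lottery.  It remains to see that its l1 norm S exceeds
    0.022 whatever RF is: subtracting the first row of C Z = mu - RF 1 from the
    third one eliminates RF, and since every entry of that difference of rows of
    C is at most 4.711 in absolute value, 0.266 - 0.057 <= 4.711 S. *)

(** The left kernel is trivial: [x *m typical_C R = 0] is a numerical linear system of five
    equations, from which [lra] derives that each unknown vanishes, so no determinant is
    computed. *)
Lemma typical_C_unitmx (R : realType) : typical_C R \in unitmx.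
Proof.
rewrite -row_free_unit; apply: inj_row_free => x xC0.
have row0 j : \sum_(i < 5) x 0 i * typical_C R i j = 0.
  by have /matrixP/(_ 0 j) := xC0; rewrite !mxE.
have := (row0 0, row0 1, row0 2%:R, row0 3%:R, row0 4%:R).
rewrite !big_ord_recr !big_ord0 !mxE /= /dec.
set x0 := x 0 _; set x1 := x 0 _; set x2 := x 0 _.
set x3 := x 0 _; set x4 := x 0 _.
move=> [[[[e0 e1] e2] e3] e4].
have [z0 z1 z2 z3 z4] : [/\ x0 = 0, x1 = 0, x2 = 0, x3 = 0 & x4 = 0].
  by split; lra.
apply/rowP => i; rewrite mxE.
(* The ordinals left by unrolling the sums agree with [i] only in value, hence [val_inj]. *)
case: i => [[|[|[|[|[|//]]]]] lt_i]; [rewrite -[RHS]z0|rewrite -[RHS]z1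
  |rewrite -[RHS]z2|rewrite -[RHS]z3|rewrite -[RHS]z4];
  by congr (x 0 _); apply: val_inj.
Qed.

Lemma C_hat_unitmx (R : realType) (v : R) : v != 0 -> C_hat v \in unitmx.
Proof.
move=> v_neq0; rewrite unitmxE det_ublock unitrM -!unitmxE typical_C_unitmx.
by rewrite unitmxE det_scalar expr1 unitfE.
Qed.

Lemma portfolio_direction_hat (R : realType) (RF RL v : R) : v != 0 ->
  portfolio_direction (mu_hat RL) (C_hat v) RF =
  col_mx (portfolio_direction (typical_mu R) (typical_C R) RF)
         (const_mx ((RL - RF) / v)).
Proof.
(* It suffices to compare both sides after multiplication by [C_hat v], which avoids inverting a
   block matrix. *)
move=> v_neq0; rewrite -[RHS](mulKmx (C_hat_unitmx _ _ v_neq0)); congr (_ *m _).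
rewrite mul_block_col !mul0mx.
rewrite mulKVmx ?typical_C_unitmx // addr0 add0r mul_scalar_mx.
rewrite -col_mx_const scale_col_mx opp_col_mx add_col_mx; congr col_mx.
by apply/matrixP => i j; rewrite !mxE mulr1 [RHS]mulrC divfK.
Qed.

Lemma typical_direction_norm_gt (R : realType) (RF : R) :
  dec R 0 022 <
  \sum_(k < 5) `|portfolio_direction (typical_mu R) (typical_C R) RF k 0|.
Proof.
set Z := portfolio_direction _ _ _.
have CZ : typical_C R *m Z = typical_mu R - RF *: const_mx 1.
  by rewrite mulKVmx ?typical_C_unitmx.
have rowZ i : \sum_(k < 5) typical_C R i k * Z k 0 = typical_mu R i 0 - RF.
  by have /matrixP/(_ i 0) := CZ; rewrite !mxE mulr1.
(* The bound is attained in the third column: 4.748 - 0.037 = 4.711. *)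
have le_row (k : 'I_5) : `|typical_C R 2%:R k - typical_C R 0 k| <= dec R 4 711.
  rewrite !mxE /dec ler_norml.
  by case: k => [[|[|[|[|[|//]]]]] lt_k] /=; apply/andP; split; lra.
have gap : typical_mu R 2%:R 0 - typical_mu R 0 0 <= dec R 4 711 * \sum_k `|Z k 0|.
  have -> : typical_mu R 2%:R 0 - typical_mu R 0 0 =
      \sum_k (typical_C R 2%:R k - typical_C R 0 k) * Z k 0.
    under eq_bigr do rewrite mulrBl.
    by rewrite sumrB !rowZ; ring.
  rewrite mulr_sumr; apply: ler_sum => k _; apply: le_trans (ler_norm _) _.
  by rewrite normrM ler_wpM2r.
(* Here 0.209 / 4.711 > 0.044, twice the required 0.022. *)
by move: gap; rewrite !mxE /= /dec; lra.
Qed.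

Theorem mainTheorem2 (R : realType) (RF RL v theta : R)
  (RF_gt0 : 0 < RF) (RF_lt_RL : RF < RL) (v_gt0 : 0 < v) (theta_gt0 : 0 < theta)
  (v_ge : (RL - RF) / (dec R 0 022 * theta) <= v) :
  negligible theta (efficient_portfolio (mu_hat RL) (C_hat v) RF) lottery.
Proof.
have d_gt0 : 0 < dec R 0 022 by rewrite /dec; lra.
rewrite /negligible /fraction_invested /efficient_portfolio.
rewrite portfolio_direction_hat ?gt_eqF // mxE big_split_ord /= big_ord1.
under eq_bigr do rewrite col_mxEu.
rewrite !col_mxEd !mxE.
have := typical_direction_norm_gt R RF.
set S := \sum_(k < 5) _ => S_gt.
set z := (RL - RF) / v.
have z_gt0 : 0 < z by rewrite divr_gt0 // subr_gt0.
have z_le : z <= dec R 0 022 * theta.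
  by rewrite ler_pdivrMr // mulrC -ler_pdivrMr // mulr_gt0.
have Sz_gt : dec R 0 022 < S + z by rewrite ltr_wpDr // ltW.
rewrite (gtr0_norm z_gt0) gtr0_norm; last first.
  by rewrite mulr_gt0 // invr_gt0 (lt_trans d_gt0).
(* The fraction is [z / (S + z)], and z <= 0.022 theta < (S + z) theta. *)
rewrite mulrC ltr_pdivrMr ?(lt_trans d_gt0) //.
by rewrite (le_lt_trans z_le) // mulrC ltr_pM2l.
Qed.
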